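(* For $u\in[-1,1]$ and $\alpha>0$ define $$\gamma_{\mathrm{Huber}}(u,\alpha)=\frac{u^2}{2\alpha}+\Big(\alpha+\frac1\alpha\Big)\Phi\Big(\frac1\alpha\Big)+\phi\Big(\frac1\alpha\Big)-\frac{\alpha}{2}-\frac1\alpha,\qquad \gamma_{\mathrm{OGD}}(u,\alpha)=\frac12\Big(\frac{u^2}{\alpha}+\alpha\Big),$$ where $\Phi$ and $\phi$ are the standard normal CDF and density. Then $\gamma_{\mathrm{Huber}}(u,\alpha)<\gamma_{\mathrm{OGD}}(u,\alpha)$ for all $u\in[-1,1]$ and $\alpha>0$. Furthermore, for every $u\in[-1,1]$, $\lim_{\alpha\to\infty}\gamma_{\mathrm{Huber}}(u,\alpha)=\sqrt{2/\pi}$ while $\lim_{\alpha\to\infty}\gamma_{\mathrm{OGD}}(u,\alpha)=\infty$. *)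

(* Defs.v *)
From mathcomp Require Export all_boot all_order all_algebra.
From mathcomp Require Export all_classical all_reals all_analysis.
Export Order.TTheory GRing.Theory Num.Theory.
Export numFieldNormedType.Exports.

Set Implicit Arguments.
Unset Strict Implicit.
Unset Printing Implicit Defensive.

Local Open Scope classical_set_scope.
Local Open Scope ring_scope.

Definition std_normal_pdf (R : realType) (x : R) : R := normal_pdf 0 1 x.

(* [fine] loses nothing: [normal_prob 0 1] is a probability measure. *)
Definition std_normal_cdf (R : realType) (x : R) : R :=
  fine (normal_prob 0 1 `]-oo, x]).

Definition gamma_Huber (R : realType) (u alpha : R) : R :=
  u ^+ 2 / (2 * alpha)
  + (alpha + 1 / alpha) * std_normal_cdf (1 / alpha)
  + std_normal_pdf (1 / alpha)
  - alpha / 2 - 1 / alpha.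

Definition gamma_OGD (R : realType) (u alpha : R) : R :=
  1 / 2 * (u ^+ 2 / alpha + alpha).

(* Main.v *)
(** With [x = 1 / alpha], the difference [gamma_OGD u alpha - gamma_Huber u alpha]
    equals [alpha * ((1 + x^2) (1 - Phi x) - x phi x)], whatever [u] is, so the
    inequality is the classical lower bound on the Mills ratio.  That bound holds
    because [1 - Phi x - x phi x / (1 + x^2)] has derivative
    [- 2 phi x / (1 + x^2)^2 < 0] and tends to 0 at infinity.

    For the limit, as [Phi 0 = 1/2],
    [gamma_Huber u alpha = u^2 x / 2 + (Phi x - Phi 0) / x + x Phi x + phi x - x],
    where the difference quotient tends to [Phi' 0 = phi 0] as [x] tends to 0; the
    limit is [2 phi 0 = sqrt (2 / pi)]. *)
Require Import Defs.
From HB Require Import structures.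
From mathcomp Require Import ring lra.

Local Open Scope classical_set_scope.
Local Open Scope ring_scope.

Section GammaHuber.
Context {R : realType}.
Implicit Types x : R.

Lemma std_normal_pdfE x :
  std_normal_pdf x = normal_peak 1 * expR (- (x ^+ 2 / 2)).
Proof.
rewrite /std_normal_pdf normal_pdfE ?oner_eq0//.
by rewrite /normal_fun subr0 expr1n mulNr.
Qed.

Lemma std_normal_pdf_gt0 x : 0 < std_normal_pdf x.
Proof.
by rewrite std_normal_pdfE mulr_gt0 ?expR_gt0// normal_peak_gt0// oner_eq0.
Qed.

Lemma is_derive_std_normal_pdf x :
  is_derive x 1 (@std_normal_pdf R) (- (x * std_normal_pdf x)).
Proof.
have -> : @std_normal_pdf R = fun y => normal_peak 1 * expR (- (y ^+ 2 / 2)).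
  by apply/funext => y; exact: std_normal_pdfE.
apply: is_derive_eq.
rewrite /GRing.scale /=.
by field.
Qed.

(** The fundamental theorem of calculus on the half-line from [-oo], for the continuous integrable
    density; [x + 1] merely supplies an endpoint to the right of [x]. *)
Lemma is_derive_std_normal_cdf x :
  is_derive x 1 (@std_normal_cdf R) (std_normal_pdf x).
Proof.
have := @continuous_FTC1 R (normal_pdf 0 1) -oo%O x (x + 1).
rewrite ltrDl ltr01 ltNyr => /(_ isT) [].
- by apply: integrableS (integrable_normal_pdf 0 1).
- by [].
- by apply: continuous_normal_pdf; rewrite oner_eq0.
rewrite derive1E.
by move=> dF F'; apply: DeriveDef.
Qed.

(* [idfun] has no canonical instance as a random variable on the reals. *)
Let idTR : measurableTypeR R -> R := idfun.

#[local] HB.instance Definition _ :=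
  @isMeasurableFun.Build _ _ _ _ idTR (@measurable_id _ _ setT).

(** [std_normal_cdf] is the distribution function of the identity random variable under
    [normal_prob 0 1]. *)
Lemma cvg_std_normal_cdf : std_normal_cdf x @[x --> +oo] --> (1 : R).
Proof.
apply/fine_cvg.
exact: (cvg_cdfy1 (P := normal_prob (0 : R) 1) idTR).
Qed.

(** The density is even, so the total mass 1 is twice its integral over the nonnegative reals, which
    the substitution of [- x] for [x] carries to []-oo, 0]]. *)
Lemma std_normal_cdf0 : std_normal_cdf 0 = 1 / 2 :> R.
Proof.
have c : continuous (normal_pdf (0 : R) 1).
  by apply: continuous_normal_pdf; rewrite oner_eq0.
have E : (normal_pdf (0 : R) 1) =1 (normal_pdf 0 1) \o -%R.
  by move=> x /=; rewrite -!/(std_normal_pdf _) !std_normal_pdfE sqrrN.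
have := integral_normal_pdf (0 : R) 1.
rewrite ge0_symfun_integralT//; last by move=> x; exact: normal_pdf_ge0.
have -> : (\int[lebesgue_measure]_(x in [set x : R | (0 <= x)%R])
    (normal_pdf 0 1 x)%:E)%E = normal_prob (0 : R) 1 `]-oo, 0].
  rewrite /normal_prob -[X in `]-oo, X]]oppr0 ge0_integration_by_substitutionNy//.
  - rewrite set_itvcy; apply: eq_integral => x _.
    by rewrite E.
  - exact: continuous_subspaceT.
  - by move=> x _; exact: normal_pdf_ge0.
rewrite -[normal_prob _ _ _]fineK ?fin_num_measure// -/(std_normal_cdf 0).
rewrite -EFinM => -[]; lra.
Qed.

Lemma cvg_inv_pinfty : y^-1 @[y --> +oo] --> (0 : R).
Proof.
apply: (gtr0_cvgV0 (f := id) _).2 => //.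
exact: nbhs_pinfty_gt.
Qed.

Lemma mills_ratio_lower_bound x :
  x * std_normal_pdf x < (1 + x ^+ 2) * (1 - std_normal_cdf x).
Proof.
have sqp (y : R) : 0 < 1 + y ^+ 2 by rewrite ltr_pwDl// sqr_ge0.
pose F y : R := 1 - std_normal_cdf y - y * std_normal_pdf y / (1 + y ^+ 2).
have dF (y : R) : is_derive y 1 F (- (2 * std_normal_pdf y / (1 + y ^+ 2) ^+ 2)).
  have ? := is_derive_std_normal_cdf y.
  have ? := is_derive_std_normal_pdf y.
  have nz : 1 + y ^+ 2 != 0 by rewrite gt_eqF.
  have ? : is_derive y 1 (fun z : R => (1 + z ^+ 2)^-1)
      (- (1 + y ^+ 2) ^- 2 * (2 * y)).
    by apply: is_derive_eq; rewrite /GRing.scale /=; field.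
  rewrite /F; apply: is_derive_eq; rewrite /GRing.scale /=.
  by field.
have F0 : F y @[y --> +oo] --> 0.
  rewrite -[X in _ --> X](subr0 0) -[in X in X - _](subrr 1).
  apply: cvgB; first by apply: cvgB; [exact: cvg_cst|exact: cvg_std_normal_cdf].
  (* For [y > 0], the bounds [y ^+ 2 <= 1 + y ^+ 2] and [std_normal_pdf y <= normal_peak 1] dominate
     the quotient by [normal_peak 1 / y]. *)
  apply: (@squeeze_cvgr _ _ _ _ (cst 0) (fun y => normal_peak 1 * y^-1)).
  - near=> y.
    have y0 : 0 < y by near: y; exact: nbhs_pinfty_gt.
    have p0 := std_normal_pdf_gt0 y; have s0 := sqp y.
    rewrite /= divr_ge0 ?mulr_ge0 ?(ltW y0) ?(ltW p0) ?(ltW s0)//=.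
    rewrite ler_pdivrMr// mulrAC ler_pdivlMr//.
    rewrite mulrAC -expr2 [leRHS]mulrC.
    apply: ler_pM; rewrite ?sqr_ge0 ?(ltW p0) ?lerDr//.
    by apply: normal_pdf_ub; rewrite oner_eq0.
  - exact: cvg_cst.
  - rewrite -[X in _ --> X](mulr0 (normal_peak 1)).
    by apply: cvgMr; exact: cvg_inv_pinfty.
have Flt y z : y < z -> F z < F y.
  move=> yz.
  apply: (ltr0_derive1_lt_cc (a := y) (b := z)); rewrite ?in_itv/= ?lexx ?ltW//.
  - move=> t _; rewrite derive1E derive_val oppr_lt0.
    by rewrite divr_gt0 ?mulr_gt0 ?std_normal_pdf_gt0 ?exprn_gt0.
  - by apply: derivable_within_continuous => t _; exact: ex_derive.
(* The limit 0 gives only a weak inequality; stopping at [x + 1] leaves room for the strict decrease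
   from [x] to [x + 1]. *)
have F1 : 0 <= F (x + 1).
  apply: (cvgr_to_le F0); near=> y; apply/ltW/Flt.
  by near: y; apply: nbhs_pinfty_gt; exact: num_real.
have : 0 < F x by apply: le_lt_trans F1 _; apply: Flt; rewrite ltrDl.
by rewrite /F subr_gt0 ltr_pdivrMr// mulrC [ltRHS]mulrC.
Unshelve. all: by end_near. Qed.

Lemma gamma_Huber_lt_OGD (u alpha : R) : 0 < alpha ->
  gamma_Huber u alpha < gamma_OGD u alpha.
Proof.
move=> a0; rewrite -subr_gt0.
have := mills_ratio_lower_bound (1 / alpha).
rewrite -subr_gt0 -(pmulr_rgt0 _ a0).
congr (0 < _); rewrite /gamma_OGD /gamma_Huber.
by field; rewrite gt_eqF.
Qed.

Lemma cvg_gamma_Huber (u : R) :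
  gamma_Huber u alpha @[alpha --> +oo] --> Num.sqrt (2 / pi : R).
Proof.
have V0 := cvg_inv_pinfty.
(* The punctured filter is needed because the difference quotient defining the derivative at 0
   converges along nonzero increments. *)
have V1 : alpha^-1 @[alpha --> +oo] --> (0 : R)^'.
  move=> A /V0; apply: filterS2 (nbhs_pinfty_gt (num_real 0)) => alpha /= a0; apply.
  by rewrite invr_eq0 gt_eqF.
have phi0 : std_normal_pdf 0 + std_normal_pdf 0 = Num.sqrt (2 / pi) :> R.
  rewrite std_normal_pdfE expr0n/= mul0r oppr0 expR0 mulr1 /normal_peak.
  rewrite expr1n mul1r -[_ *+ 2]mulr_natl -mulr2n -[LHS]mulr_natl.
  move: (pi : R) (pi_gt0 R) => p p0.
  (* The left side, twice the inverse of a square root, is nonnegative, hence the square root of its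
     own square; it remains to compare radicands. *)
  rewrite -[LHS]ger0_norm ?mulr_ge0 ?invr_ge0 ?sqrtr_ge0// -sqrtr_sqr.
  congr Num.sqrt; rewrite exprMn exprVn sqr_sqrtr ?mulr_ge0 ?ltW//.
  by field; rewrite gt_eqF.
pose G (y : R) := u ^+ 2 / 2 * y + (std_normal_cdf y - std_normal_cdf 0) / y
  + y * std_normal_cdf y + std_normal_pdf y - y.
have GV : G alpha^-1 @[alpha --> +oo] --> std_normal_pdf 0 + std_normal_pdf 0.
  rewrite /G.
  have cp : std_normal_pdf alpha^-1 @[alpha --> +oo] --> (std_normal_pdf 0 : R).
    by apply: (cvg_comp _ _ V0); apply: continuous_normal_pdf; rewrite oner_eq0.
  have cc : std_normal_cdf alpha^-1 @[alpha --> +oo] --> (std_normal_cdf 0 : R).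
    apply: (cvg_comp _ _ V0); apply/differentiable_continuous/derivable1_diffP.
    by have [] := is_derive_std_normal_cdf 0.
  have cd : (std_normal_cdf alpha^-1 - std_normal_cdf 0) / alpha^-1
      @[alpha --> +oo] --> (std_normal_pdf 0 : R).
    have [d dE] := is_derive_std_normal_cdf 0.
    have {d} : h^-1 *: (std_normal_cdf (h *: 1 + 0) - std_normal_cdf 0)
        @[h --> (0 : R)^'] --> (std_normal_pdf 0 : R).
      by rewrite -dE; exact: d.
    move=> /(cvg_comp _ _ V1); apply: cvg_trans; apply: near_eq_cvg; near=> alpha.
    by rewrite /= [_ *: 1]mulr1 addr0 [LHS]mulrC.
  have -> : std_normal_pdf 0 + std_normal_pdf 0 =
    u ^+ 2 / 2 * 0 + std_normal_pdf 0 + 0 * std_normal_cdf 0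
    + std_normal_pdf 0 - 0 :> R by ring.
  apply: (cvgB _ V0); apply: (cvgD _ cp); apply: (cvgD _ (cvgM V0 cc)).
  by apply: (cvgD _ cd); apply: cvgMr.
rewrite -phi0; apply: cvg_trans GV; apply: near_eq_cvg; near=> alpha.
have a0 : 0 < alpha by near: alpha; exact: nbhs_pinfty_gt.
rewrite /G /gamma_Huber !div1r std_normal_cdf0; field.
by rewrite gt_eqF.
Unshelve. all: by end_near. Qed.

Lemma cvg_gamma_OGD (u : R) : gamma_OGD u alpha @[alpha --> +oo] --> +oo.
Proof.
(* Dropping the nonnegative term in [u ^+ 2] leaves the divergent minorant [a / 2]. *)
apply: (@ger_cvgy _ _ _ _ (fun a => a * (1 / 2))); last first.
  by apply: gt0_cvgMly => //; rewrite divr_gt0.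
near=> a.
have a0 : 0 < a by near: a; exact: nbhs_pinfty_gt.
by rewrite /gamma_OGD mulrC ler_pM2l ?divr_gt0// lerDr divr_ge0 ?sqr_ge0 ?ltW.
Unshelve. all: by end_near. Qed.

End GammaHuber.

Theorem mainTheorem4 (R : realType) :
  (forall u alpha : R, -1 <= u <= 1 -> 0 < alpha ->
     gamma_Huber u alpha < gamma_OGD u alpha) /\
  (forall u : R, -1 <= u <= 1 ->
     (gamma_Huber u alpha @[alpha --> +oo] --> Num.sqrt (2 / pi)) /\
     (gamma_OGD u alpha @[alpha --> +oo] --> +oo)).
Proof.
split=> [u alpha _ a0|u _]; first exact: gamma_Huber_lt_OGD.
by split; [exact: cvg_gamma_Huber|exact: cvg_gamma_OGD].
Qed.
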